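(* Let $X$ be a non-negative random variable with pdf $f$ and cdf $F$, let $n$ be a positive integer, and let $t>0$ with $F(t)>0$. Then $\mathcal{CE}_{\alpha}(\boldsymbol X_{\rm MRSSU};t)\leq\mathcal{CE}_{\alpha}(\boldsymbol X_{\rm SRS};t)$ for $0<\alpha<1$, and $\mathcal{CE}_{\alpha}(\boldsymbol X_{\rm MRSSU};t)\geq\mathcal{CE}_{\alpha}(\boldsymbol X_{\rm SRS};t)$ for $\alpha>1$.
   Context: $X$ is non-negative and absolutely continuous. $\boldsymbol X_{\rm SRS}$ is a simple random sample of size $n$ from $X$; $\boldsymbol X_{\rm MRSSU}$ (maximum ranked set sampling with unequal samples, size $n$) is a vector of $n$ independent random variables whose $i$-th component is the maximum of a simple random sample of size $i$ from $X$, with cdf $[F(x)]^i$. The dynamic cumulative Tsallis entropy of order $\alpha>0$, $\alpha\neq1$, of $X$ is $\mathcal{CE}_{\alpha}(X;t)=\frac{1}{1-\alpha}\left(\int_{0}^{t}\left(\frac{F(x)}{F(t)}\right)^{\alpha}dx-1\right)$, and for the samples $$\mathcal{CE}_{\alpha}(\boldsymbol X_{\rm SRS};t)=\frac{1}{1-\alpha}\left[\left(\int_{0}^{t}\left(\frac{F(x)}{F(t)}\right)^{\alpha}dx\right)^{n}-1\right],$$ $$\mathcal{CE}_{\alpha}(\boldsymbol X_{\rm MRSSU};t)=\frac{1}{1-\alpha}\left[\prod_{i=1}^{n}\int_{0}^{t}\left(\frac{F(x)}{F(t)}\right)^{i\alpha}dx-1\right].$$ *)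

(* Defs.v *)
From HB Require Import structures.
From mathcomp Require Import all_boot all_order all_algebra.
From mathcomp Require Import all_classical all_reals all_analysis.

Set Implicit Arguments.
Unset Strict Implicit.
Unset Printing Implicit Defensive.

Import Order.TTheory GRing.Theory Num.Theory.
Import numFieldNormedType.Exports.
Local Open Scope classical_set_scope.
Local Open Scope ring_scope.

Definition Rcdf (d : measure_display) (T : measurableType d) (R : realType)
    (P : probability T R) (X : {RV P >-> R}) (x : R) : R :=
  fine (cdf X x).

Definition is_pdf (d : measure_display) (T : measurableType d) (R : realType)
    (P : probability T R) (X : {RV P >-> R}) (f : R -> R) : Prop :=
  [/\ measurable_fun setT f,
      forall x, 0 <= f x &
      forall A : set R, measurable A ->
        distribution P X A = (\int[@lebesgue_measure R]_(x in A) (f x)%:E)%E].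

(* Both sample entropies depend on the sampling scheme only through the cdfs of
   its independent components: F (n times) for simple random sampling, and
   F, F^2, ..., F^n for maximum ranked set sampling with unequal samples (the
   maximum of i independent copies of X has cdf F^i). They are therefore
   functionals of the law of X and of the sample size n. *)

Definition CE_SRS (d : measure_display) (T : measurableType d) (R : realType)
    (P : probability T R) (alpha : R) (X : {RV P >-> R}) (n : nat) (t : R)
    : R :=
  (1 - alpha)^-1 *
  ((\int[@lebesgue_measure R]_(x in `[0, t])
      ((Rcdf X x / Rcdf X t) `^ alpha)) ^+ n
   - 1).

Definition CE_MRSSU (d : measure_display) (T : measurableType d) (R : realType)
    (P : probability T R) (alpha : R) (X : {RV P >-> R}) (n : nat) (t : R)
    : R :=
  (1 - alpha)^-1 *
  (\prod_(1 <= i < n.+1)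
      (\int[@lebesgue_measure R]_(x in `[0, t])
         ((Rcdf X x / Rcdf X t) `^ (i%:R * alpha)))
   - 1).

(* Main.v *)
Require Import Defs.
From HB Require Import structures.
From mathcomp Require Import all_boot all_order all_algebra.
From mathcomp Require Import all_classical all_reals all_analysis.
From mathcomp Require Import measurable_realfun.

Set Implicit Arguments.
Unset Strict Implicit.
Unset Printing Implicit Defensive.

Import Order.TTheory GRing.Theory Num.Theory.
Import numFieldNormedType.Exports.
Local Open Scope classical_set_scope.
Local Open Scope ring_scope.

(** For x in [0, t] the ratio u = F(x)/F(t) lies in [0, 1], so raising the exponent from alpha to i
    alpha with i >= 1 can only decrease the power of u. Integrating over [0, t] and multiplying the
    n nonnegative integrals bounds the MRSSU product by the SRS n-th power
    ([prod_integral_Rcdf_le]), for every alpha > 0. The two cases of the theorem differ only in the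
    sign of 1/(1 - alpha). *)

Lemma powR_le_exponent01 (R : realType) (u a b : R) :
  0 <= u <= 1 -> 0 < a -> a <= b -> u `^ b <= u `^ a.
Proof.
move=> /andP[]; rewrite le_eqVlt => /predU1P[<- _|u0 u1] a0 ab.
  (* At u = 0 both powers vanish because both exponents are positive; a zero exponent would give
     1. *)
  by rewrite !powR0 ?gt_eqF// (lt_le_trans a0).
by apply: ger_powR => //; rewrite u0.
Qed.

Lemma Rcdf_ge0 (d : measure_display) (T : measurableType d) (R : realType)
    (P : probability T R) (X : {RV P >-> R}) (x : R) : 0 <= Rcdf X x.
Proof. exact/fine_ge0/cdf_ge0. Qed.

Lemma Rcdf_nondecreasing (d : measure_display) (T : measurableType d)
    (R : realType) (P : probability T R) (X : {RV P >-> R}) :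
  nondecreasing_fun (Rcdf X).
Proof.
by move=> x y xy; rewrite fine_le ?fin_num_measure//; exact: cdf_nondecreasing.
Qed.

Lemma Rcdf_ratio01 (d : measure_display) (T : measurableType d) (R : realType)
    (P : probability T R) (X : {RV P >-> R}) (t x : R) :
  0 < Rcdf X t -> x <= t -> 0 <= Rcdf X x / Rcdf X t <= 1.
Proof.
move=> Ft xt; rewrite divr_ge0 ?Rcdf_ge0//= ler_pdivrMr// mul1r.
exact: Rcdf_nondecreasing.
Qed.

(** Monotonicity of the real-valued integral requires integrability. Here the integrand is monotone
    in x, hence measurable, and bounded by 1 on an interval of finite measure. *)
Lemma integrable_Rcdf_powR (d : measure_display) (T : measurableType d)
    (R : realType) (P : probability T R) (X : {RV P >-> R}) (t a : R) :
  0 < Rcdf X t -> 0 <= a ->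
  (@lebesgue_measure R).-integrable `[0, t]
    (EFin \o (fun x => (Rcdf X x / Rcdf X t) `^ a)).
Proof.
move=> Ft a0; apply: measurable_bounded_integrable => //.
- by rewrite /= lebesgue_measure_itv/=; case: ifP => _; rewrite ?ltry.
- apply: nondecreasing_measurable => // x y xy.
  apply: ge0_ler_powR; rewrite ?nnegrE ?divr_ge0 ?Rcdf_ge0//.
  by rewrite ler_pM2r ?invr_gt0//; exact: Rcdf_nondecreasing.
- exists 1; split; first exact: num_real.
  move=> M M1 x /=; rewrite in_itv/= => /andP[_ xt].
  have /andP[u0 u1] := Rcdf_ratio01 Ft xt.
  rewrite ger0_norm ?powR_ge0// (le_trans _ (ltW M1))//.
  have -> : 1 = 1 `^ a :> R by rewrite powR1.
  by apply: ge0_ler_powR; rewrite ?nnegrE.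
Qed.

Lemma prod_integral_Rcdf_le (d : measure_display) (T : measurableType d)
    (R : realType) (P : probability T R) (X : {RV P >-> R}) (n : nat)
    (t a : R) :
  0 < Rcdf X t -> 0 < a ->
  \prod_(1 <= i < n.+1)
      (\int[@lebesgue_measure R]_(x in `[0, t])
         ((Rcdf X x / Rcdf X t) `^ (i%:R * a))) <=
  (\int[@lebesgue_measure R]_(x in `[0, t])
      ((Rcdf X x / Rcdf X t) `^ a)) ^+ n.
Proof.
(* Writing the power as a product over the same indices allows a factor-by-factor comparison. *)
move=> Ft a0; have expE (y : R) : y ^+ n = \prod_(1 <= i < n.+1) y.
  by rewrite prodr_const_nat subn1.
rewrite expE !big_nat; apply: ler_prod => i /andP[i1 _].
rewrite Rintegral_ge0 => [|x _]; last exact: powR_ge0.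
apply: le_Rintegral => //.
- by apply: integrable_Rcdf_powR => //; rewrite mulr_ge0// ltW.
- by apply: integrable_Rcdf_powR => //; exact: ltW.
- move=> x /=; rewrite in_itv/= => /andP[_ xt].
  apply: powR_le_exponent01 => //; first exact: Rcdf_ratio01.
  (* The index range starts at 1, so a <= i a. *)
  by rewrite ler_peMl ?ler1n// ltW.
Qed.

Theorem theorem3p4 (d : measure_display) (T : measurableType d) (R : realType)
    (P : probability T R) (X : {RV P >-> R}) (f : R -> R)
    (X_ge0 : {ae P, forall w, 0 <= X w}) (X_pdf : is_pdf X f)
    (n : nat) (n_gt0 : (0 < n)%N)
    (t : R) (t_gt0 : 0 < t) (Ft_gt0 : 0 < Rcdf X t) :
  (forall alpha : R, 0 < alpha -> alpha < 1 ->
     CE_MRSSU alpha X n t <= CE_SRS alpha X n t) /\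
  (forall alpha : R, 1 < alpha ->
     CE_SRS alpha X n t <= CE_MRSSU alpha X n t).
Proof.
split=> alpha => [alpha_gt0 alpha_lt1|alpha_gt1].
  apply: ler_wpM2l; first by rewrite invr_ge0 subr_ge0 ltW.
  by rewrite lerD2r; exact: prod_integral_Rcdf_le.
(* For alpha > 1 the prefactor is negative and reverses the inequality. *)
apply: ler_wnM2l; first by rewrite invr_le0 subr_le0 ltW.
by rewrite lerD2r; apply: prod_integral_Rcdf_le => //; exact: lt_trans alpha_gt1.
Qed.
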